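(* For any integer $n\geq 1$, $$\sum_{k=0}^n\binom{k}{2}\left[{n \atop k}\right]_q (-1)^kq^{\binom{k}{2}}=(q ; q)_{n-1} \sum_{k=1}^{n-1} \frac{q^k}{1-q^k}.$$ In particular, $$\sum_{k=0}^{\infty}\binom{k}{2}\frac{(-1)^kq^{\binom{k}{2}}}{(q;q)_k}=(q ; q)_{\infty} \sum_{k=1}^{\infty} \frac{q^k}{1-q^k}.$$
   Context: $q$ is a complex number with $0<|q|<1$. $(a;q)_\infty=\prod_{j=0}^{\infty}(1-aq^j)$; for an integer $n\ge 0$, $(a;q)_n=\prod_{j=0}^{n-1}(1-aq^j)$; the $q$-binomial coefficient is $\left[{n\atop k}\right]_q=\frac{(q;q)_n}{(q;q)_k(q;q)_{n-k}}$. *)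

(* Defs.v *)
From HB Require Import structures.
From mathcomp Require Import all_boot all_order all_algebra.
From mathcomp Require Import all_classical all_reals all_analysis.
From mathcomp Require Export complex.

Set Implicit Arguments.
Unset Strict Implicit.
Unset Printing Implicit Defensive.

Import Order.TTheory GRing.Theory Num.Theory.
Import numFieldNormedType.Exports.

Local Open Scope ring_scope.
Local Open Scope classical_set_scope.
Local Open Scope complex_scope.

(* [R[i]] carries no topology in the libraries. It is given here the metric of
   its modulus, i.e. the one attached to every [numFieldType] [K] through [K^o]
   (the same device as [Rstruct_topology] for the Stdlib reals). *)
HB.instance Definition _ (R : realType) := PseudoMetric.copy R[i] R[i]^o.
HB.instance Definition _ (R : realType) := Pointed.copy R[i] R[i]^o.

Definition qpoch (K : numFieldType) (a q : K) (n : nat) : K :=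
  \prod_(0 <= j < n) (1 - a * q ^+ j).

(* The limit of [qpoch a q n] as [n] grows; like every [lim] it is a default
   value when the partial products do not converge. *)
Definition qpoch_inf (R : realType) (a q : R[i]) : R[i] :=
  \big[*%R/1]_(0 <= j <oo) (1 - a * q ^+ j).

(* Only meaningful for [k <= n]: [n - k] is truncated, so this is not [0] for
   [k > n]. *)
Definition qbinom (K : numFieldType) (q : K) (n k : nat) : K :=
  qpoch q q n / (qpoch q q k * qpoch q q (n - k)).

(* Main.v *)
Require Import Defs.
From mathcomp Require Import all_boot all_order all_algebra.
From mathcomp Require Import all_classical all_reals all_analysis.
From mathcomp Require Import ring zify.

Import Order.TTheory GRing.Theory Num.Theory.
Import numFieldNormedType.Exports.

Local Open Scope ring_scope.
Local Open Scope classical_set_scope.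
Local Open Scope complex_scope.

(* By the q-binomial theorem the finite sum is half the second derivative at 1
   of P(X) = \prod_(0 <= j < n) (1 - q^j X).  Writing P = (1 - X) Q, this is
   - Q'(1), and the logarithmic derivative of Q gives the right-hand side.

   For the infinite identity, let n tend to infinity.  The finite sum differs
   from the partial sum of the series by
     \sum_k C(k, 2) (-1)^k q^C(k, 2) / (q;q)_k
              * ((q;q)_n - (q;q)_(n-k)) / (q;q)_(n-k).
   Since (q;q)_n and its inverse are bounded, the k-th term is at most a
   constant times C(k, 2) |q|^(C(k, 2) + n - k), and 2 k <= C(k, 2) + 3 makes
   the whole difference O(|q|^n). *)

(** * The finite identity, from the q-binomial theorem *)

Lemma qpochS (K : numFieldType) (a q : K) (n : nat) :
  qpoch a q n.+1 = qpoch a q n * (1 - a * q ^+ n).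
Proof. by rewrite /qpoch big_nat_recr. Qed.

Lemma qpoch_neq0 {K : numFieldType} {q : K} (n : nat) :
  (forall j, q ^+ j.+1 != 1) -> qpoch q q n != 0.
Proof.
move=> q1; elim: n => [|n IHn]; first by rewrite /qpoch big_geq ?oner_eq0.
by rewrite qpochS mulf_neq0// -exprS subr_eq0 eq_sym.
Qed.

(** Induction on [n]: multiplying by 1 - q^n X amounts to the q-Pascal rule [n+1, k+1] = [n, k+1] +
    q^(n-k) [n, k]. *)
Lemma coef_qbinomial_theorem (K : numFieldType) (q : K) (n k : nat) :
  (forall j, q ^+ j.+1 != 1) ->
  (\prod_(0 <= j < n) (1 - q ^+ j *: 'X))`_k =
  if (k <= n)%N then qbinom q n k * (-1) ^+ k * q ^+ 'C(k, 2) else 0.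
Proof.
move=> q1; have p0 n0 := qpoch_neq0 n0 q1.
have qpoch0 : qpoch q q 0 = 1 by rewrite /qpoch big_geq.
elim: n k => [|n IHn] k.
  rewrite big_geq// coef1; case: k => [|k] //=.
  by rewrite /qbinom subn0 qpoch0 bin0n expr0 !mulr1 divr1.
rewrite big_nat_recr//= mulrBr mulr1 coefB -scalerAr coefZ coefMX !IHn /qbinom.
case: k => [|k] /=.
  by rewrite mulr0 subr0 !subn0 qpoch0 !mul1r !divff.
(* The case n <= k is apart because [qbinom q n k.+1] does not vanish there; for k = n the leading
   coefficient comes from the shifted term alone. *)
rewrite ltnS subSS; have [kn|nk] := ltnP k n; last first.
  case: ltngtP nk => // [|->] _; first by rewrite mulr0 subr0.
  rewrite subnn qpoch0 !mulr1 !divff// sub0r binS bin1 addnC exprD !exprS; ring.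
(* Writing n as a sum removes truncated subtraction and leaves a rational identity for [field]. *)
have [m nE] : exists m, n = (k + m.+1)%N.
  by exists (n - k.+1)%N; rewrite addnS -addSn subnKC.
have -> : (n - k.+1)%N = m by lia.
have -> : (n - k)%N = m.+1 by lia.
rewrite ltnW//= binS bin1 !qpochS.
have := p0 m; have := p0 k; have := q1 m; have := q1 k.
rewrite -!exprS !(exprS (-1)) nE -addSn !exprD -!exprS.
set A := qpoch q q _; set B := qpoch q q k; set C := qpoch q q m.
rewrite (exprS (-1)) (exprS q k); set x := q ^+ k.
set y := q ^+ m.+1; set z := q ^+ 'C(_, _).
move=> k1 m1 B0 C0; field.
by rewrite B0 C0 !subr_eq0 ![1 == _]eq_sym k1 m1.
Qed.

Lemma horner1_nderivn2 {K : numFieldType} {p : {poly K}} {m : nat} :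
  (size p <= m)%N -> p^`N(2).[1] = \sum_(0 <= k < m) 'C(k, 2)%:R * p`_k.
Proof.
move=> pm; rewrite -[in LHS](coefK p) poly_def raddf_sum horner_sum.
rewrite big_mkord (big_ord_widen m (fun k => (p`_k *: 'X^k)^`N(2).[1]))//.
rewrite [LHS]big_mkcond.
apply: eq_bigr => k _; rewrite linearZ/= nderivnXn hornerE hornerMn hornerXn.
rewrite expr1n mulrC; case: ltnP => // pk.
by rewrite nth_default ?mulr0.
Qed.

Lemma sum_bin2_qbinom {K : numFieldType} {q : K} (n : nat) :
  (forall j, q ^+ j.+1 != 1) ->
  \sum_(0 <= k < n.+2)
    'C(k, 2)%:R * qbinom q n.+1 k * (-1) ^+ k * q ^+ 'C(k, 2) =
  qpoch q q n * \sum_(1 <= k < n.+1) q ^+ k / (1 - q ^+ k).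
Proof.
move=> q1.
(* [Q n] is P for n + 1 factors with the factor 1 - X, which vanishes at 1, removed. *)
pose Q m : {poly K} := \prod_(0 <= j < m) (1 - q ^+ j.+1 *: 'X).
have Q1 m : (Q m).[1] = qpoch q q m.
  rewrite horner_prod; apply: eq_bigr => j _.
  by rewrite !hornerE exprS.
have dQ m : (Q m)^`().[1] =
    - (qpoch q q m * \sum_(1 <= k < m.+1) q ^+ k / (1 - q ^+ k)).
  elim: m => [|m IHm].
    by rewrite /Q !big_geq// -polyC1 derivC horner0 mulr0 oppr0.
  rewrite [Q _]big_nat_recr//= -/(Q m) derivM hornerD !hornerM IHm Q1.
  rewrite qpochS [in RHS]big_nat_recr//=.
  rewrite derivB derivZ derivX -polyC1 derivC !hornerE.
  set S := \sum_(_ <= _ < _) _; rewrite -exprS.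
  have := q1 m; set x := q ^+ m.+1 => x1; field.
  by rewrite subr_eq0 eq_sym.
have sP m :
    (size (\prod_(0 <= j < m) (1 - q ^+ j *: 'X) : {poly K})%R <= m.+1)%N.
  apply/leq_sizeP => k mk.
  by rewrite coef_qbinomial_theorem// leqNgt mk.
transitivity ((\prod_(0 <= j < n.+1) (1 - q ^+ j *: 'X) : {poly K})^`N(2).[1]).
  rewrite (horner1_nderivn2 (sP _)); apply: eq_big_nat => k /andP[_ kn].
  by rewrite coef_qbinomial_theorem// -ltnS kn !mulrA.
(* [((1 - X) Q)''/2 = (1 - X) Q''/2 - Q'] *)
rewrite big_nat_recl//= scale1r -/(Q n) mulrBl mul1r ['X * _]mulrC raddfB/=.
rewrite -[Q n * 'X]addr0 -polyC0 nderivnMXaddC hornerD hornerN hornerD hornerM.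
by rewrite hornerX mulr1 nderivn1 dQ addrC opprD subrK opprK.
Qed.

(** * Geometric estimates *)

(** The full series sums to r^j / (1 - r)^(j+1); the bound drops r^j. *)
Lemma sum_bin_geometric {K : numFieldType} {r : K} (j n : nat) :
  0 <= r -> r < 1 ->
  \sum_(0 <= k < n) 'C(k, j)%:R * r ^+ k <= (1 - r) ^- j.+1.
Proof.
move=> r0 r1; have r10 : 0 < 1 - r by rewrite subr_gt0.
pose S i m := \sum_(0 <= k < m) 'C(k, i)%:R * r ^+ k.
have S_le i m : S i m <= S i m.+1.
  by rewrite /S [leRHS]big_nat_recr//= lerDl mulr_ge0// exprn_ge0.
rewrite -/(S j n); elim: j n => [|j IHj] n.
  rewrite expr1 -div1r ler_pdivlMr// /S.
  under eq_bigr do rewrite bin0 mul1r.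
  rewrite mulrC -[1 - r]opprB mulNr big_mkord -subrX1 opprB.
  by rewrite lerBlDr lerDl exprn_ge0.
(* Pascal's rule gives [(1 - r) S_(j+1) <= S_j]. *)
have rec : S j.+1 n.+1 = r * (S j.+1 n + S j n).
  rewrite /S big_nat_recl//= bin0n mul0r add0r -big_split mulr_sumr.
  by apply: eq_bigr => k _ /=; rewrite binS natrD exprS; ring.
have : (1 - r) * S j.+1 n <= S j n.
  have := S_le j.+1 n; rewrite rec.
  have : r * S j n <= S j n.
    by rewrite ler_piMl ?(ltW r1)// sumr_ge0// => k _;
      rewrite mulr_ge0// exprn_ge0.
  rewrite -subr_ge0 => h1; rewrite -subr_ge0 => h2; rewrite -subr_ge0.
  by have := addr_ge0 h1 h2; congr (0 <= _); ring.
move=> /le_trans/(_ (IHj n)).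
by rewrite mulrC -ler_pdivlMr// -invfM -exprSr.
Qed.

(** The difference of the two sides is (k - 2)(k - 3) / 2. *)
Lemma leq_double_bin2 (k : nat) : (k.*2 <= 'C(k, 2) + 3)%N.
Proof.
elim: k => [//|[//|[//|k]] IHk].
by rewrite binS bin1 doubleS; lia.
Qed.

(** Trades the quadratic exponent for a linear one: r^n gives the decay, and r^k keeps the sum over
    k bounded. *)
Lemma ler_bin2_expr {K : numFieldType} {r : K} (k n : nat) : 0 < r -> r < 1 ->
  (k <= n)%N -> r ^+ 'C(k, 2) * r ^+ (n - k) <= r ^- 3 * (r ^+ n * r ^+ k).
Proof.
move=> r0 r1 kn; rewrite [leRHS]mulrC ler_pdivlMr ?exprn_gt0// -!exprD.
rewrite ler_wiXn2l ?(ltW r0) ?(ltW r1)//; have := leq_double_bin2 k; lia.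
Qed.

Lemma qpoch_dist_le {K : numFieldType} {q a : K} (m n : nat) : `|q| < 1 ->
  (forall n, `|qpoch q q n| <= a) -> (m <= n)%N ->
  `|qpoch q q n - qpoch q q m| <= a / (1 - `|q|) * `|q| ^+ m.
Proof.
move=> q1 Pa /subnK <-; have q10 : 0 < 1 - `|q| by rewrite subr_gt0.
have a0 : 0 <= a := le_trans (normr_ge0 _) (Pa 0).
set d := (n - m)%N.
(* Keeping the subtracted power makes the induction close: each new factor adds at most a
   |q|^(d+m+1), weakened to what the telescoping needs. *)
suff : `|qpoch q q (d + m) - qpoch q q m| <=
    a / (1 - `|q|) * (`|q| ^+ m - `|q| ^+ (d + m)).
  move=> /le_trans; apply; rewrite ler_wpM2l ?divr_ge0 ?(ltW q10)//.
  by rewrite lerBlDr lerDl exprn_ge0.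
elim: d => [|d IHd]; first by rewrite !subrr normr0 mulr0.
rewrite addSn qpochS mulrBr mulr1 addrAC (le_trans (ler_normB _ _))//.
rewrite -exprS normrM normrX.
apply: le_trans (_ : _ <= a / (1 - `|q|) * (`|q| ^+ m - `|q| ^+ (d + m)) +
                           a * `|q| ^+ (d + m)) _.
  by rewrite lerD// ler_pM// exprS ler_piMl ?exprn_ge0// (ltW q1).
rewrite le_eqVlt; apply/orP; left; apply/eqP; rewrite exprS; field.
by rewrite gt_eqF.
Qed.

(** * Limits and series in [R[i]], by coordinates *)

Lemma normc_ge_Im (R : rcfType) (z : R[i]) : `|complex.Im z|%:C <= `|z|.
Proof.
rewrite normc_def lecR -(sqrtr_sqr (complex.Im z)).
by rewrite ler_wsqrtr// lerDr sqr_ge0.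
Qed.

Lemma ler_normc_ReIm (R : rcfType) (z : R[i]) :
  `|z| <= (`|complex.Re z| + `|complex.Im z|)%:C.
Proof.
rewrite [X in `|X|]complexE (le_trans (ler_normD _ _))// normrM rmorphD/=.
rewrite !normc_def /= expr0n expr1n add0r sqrtr1.
by rewrite !addr0 mul1r !sqrtr_sqr.
Qed.

Lemma cvg_complexP (R : realType) (u : nat -> R[i]) (l : R[i]) :
  u @ \oo --> l <->
    complex.Re (u n) @[n --> \oo] --> complex.Re l /\
    complex.Im (u n) @[n --> \oo] --> complex.Im l.
Proof.
split=> [/cvg_ballP ul|[/cvgrPdist_lt ul /cvgrPdist_lt vl]].
  split; apply/cvgrPdist_lt => e e0;
      have e0C : 0 < e%:C :> R[i] by rewrite ltcR.
    apply: filterS (ul _ e0C) => n ln; rewrite -ltcR; apply: le_lt_trans ln.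
    by rewrite -[_ - _](raddfB (@complex.Re R)) normc_ge_Re.
  apply: filterS (ul _ e0C) => n ln; rewrite -ltcR; apply: le_lt_trans ln.
  by rewrite -[_ - _](raddfB (@complex.Im R)) normc_ge_Im.
apply/cvg_ballP => e e0.
(* The radius [e] lies in [R[i]]; positivity in its partial order forces it to be real. *)
have [d d0 ->] : exists2 d : R, 0 < d & e = d%:C.
  case: e e0 => a b; rewrite ltcE /= => /andP[/eqP -> a0]; by exists a.
have d2 : 0 < d / 2 by rewrite divr_gt0.
near=> n.
apply: le_lt_trans (ler_normc_ReIm _ (l - u n)) _.
rewrite ltcR !raddfB [ltRHS]splitr ltrD//; near: n; [exact: ul|exact: vl].
Unshelve. all: by end_near. Qed.

Lemma cvg_complex_lim {R : realType} {u : nat -> R[i]} {l : R[i]} :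
  u @ \oo --> l -> limn u = l.
Proof. apply: (@cvg_lim R[i]^o); exact: norm_hausdorff. Qed.

Lemma cvg_complexD {R : realType} {u v : nat -> R[i]} {a b : R[i]} :
  u @ \oo --> a -> v @ \oo --> b -> u n + v n @[n --> \oo] --> a + b.
Proof.
move=> /cvg_complexP[ua1 ua2] /cvg_complexP[vb1 vb2].
apply/cvg_complexP; split; rewrite raddfD.
  under eq_fun do rewrite raddfD; exact: cvgD.
under eq_fun do rewrite raddfD; exact: cvgD.
Qed.

Lemma cvg_complexM {R : realType} {u v : nat -> R[i]} {a b : R[i]} :
  u @ \oo --> a -> v @ \oo --> b -> u n * v n @[n --> \oo] --> a * b.
Proof.
have ReM (x y : R[i]) : complex.Re (x * y) =
  complex.Re x * complex.Re y - complex.Im x * complex.Im y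
  by case: x y => [? ?] [].
have ImM (x y : R[i]) : complex.Im (x * y) =
  complex.Re x * complex.Im y + complex.Im x * complex.Re y
  by case: x y => [? ?] [].
move=> /cvg_complexP[ua1 ua2] /cvg_complexP[vb1 vb2].
apply/cvg_complexP; split; rewrite (ReM, ImM).
  under eq_fun do rewrite ReM; apply: cvgB; exact: cvgM.
under eq_fun do rewrite ImM; apply: cvgD; exact: cvgM.
Qed.

Lemma ge0_complexE {R : rcfType} {z : R[i]} :
  0 <= z -> exists2 a : R, 0 <= a & z = a%:C.
Proof.
move=> z0; exists (complex.Re z); last by rewrite RRe_real// ger0_real.
by rewrite -ler0c RRe_real// ger0_real.
Qed.

(** Both coordinates are squeezed between opposite real geometric sequences; the bound at n = 0
    shows that [C] is real. *)
Lemma cvg_complex0_geometric {R : realType} {u : nat -> R[i]} (C r : R[i]) :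
  0 <= r -> r < 1 -> (forall n, `|u n| <= C * r ^+ n) -> u @ \oo --> 0.
Proof.
move=> r0 r1 ur.
have /ge0_complexE[c _ cE] : 0 <= C.
  by rewrite (le_trans (normr_ge0 (u 0)))// (le_trans (ur 0))// mulr1.
have [s s0 sE] := ge0_complexE r0.
have {}ur n : `|u n| <= (c * s ^+ n)%:C
  by have := ur n; rewrite cE sE -rmorphXn -rmorphM.
have g0 : c * s ^+ n @[n --> \oo] --> 0.
  by apply: cvg_geometric; rewrite ger0_norm// -ltcR -sE.
have g0N : - (c * s ^+ n) @[n --> \oo] --> 0 by rewrite -oppr0; exact: cvgN.
by apply/cvg_complexP; split; apply: (squeeze_cvgr _ g0N g0); near=> n;
  rewrite -ler_norml -lecR (le_trans _ (ur n))// ?normc_ge_Re ?normc_ge_Im.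
Unshelve. all: by end_near. Qed.

Lemma complex_series_is_cvg {R : realType} {u : nat -> R[i]} (B : R[i]) :
  (forall n, \sum_(0 <= k < n) `|u k| <= B) -> cvgn (series u).
Proof.
move=> uB.
have /ge0_complexE[b _ bE] : 0 <= B by have := uB 0; rewrite big_geq.
(* Stated for an additive [f] to serve both coordinates: each real series converges absolutely. *)
have part (f : {additive R[i] -> R}) : (forall z, `|f z|%:C <= `|z|) ->
    cvgn (fun n => f (series u n)).
  move=> fz; under eq_fun do rewrite raddf_sum.
  apply: normed_cvg; apply: nondecreasing_is_cvgn.
    by apply: nondecreasing_series => n _ _ /=.
  exists b => _ [n _ <-]; rewrite -lecR -bE (le_trans _ (uB n))//.
  rewrite /series/= raddf_sum; apply: ler_sum => k _; exact: fz.
have /cvg_ex[x ux] := part _ (@normc_ge_Re R).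
have /cvg_ex[y uy] := part _ (@normc_ge_Im R).
by apply/cvg_ex; exists (x +i* y); apply/cvg_complexP.
Qed.

(** * Bounds and convergence of the product and the series *)

Lemma qpoch_bounded {R : realType} {q : R[i]} : `|q| < 1 ->
  exists2 a : R[i], forall n, `|qpoch q q n| <= a
                  & forall n, `|qpoch q q n|^-1 <= a.
Proof.
have [r r0 rE] := ge0_complexE (normr_ge0 q); rewrite rE => q1.
have r1 : r < 1 by rewrite -ltcR.
have r10 : 0 < 1 - r by rewrite subr_gt0.
(* For [x = r ^+ j.+1], both [1 + x] and [(1 - x)^-1 = 1 + x / (1 - x)] are at
   most [expR (r ^+ j / (1 - r))]. *)
have prod_le (f : nat -> R[i]) n :
    (forall j, `|f j| <= (expR (r ^+ j / (1 - r)))%:C) ->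
    `|\prod_(0 <= j < n) f j| <= (expR ((1 - r) ^- 2))%:C.
  move=> fle; rewrite normr_prod.
  apply: (@le_trans _ _ (\prod_(0 <= j < n) (expR (r ^+ j / (1 - r)))%:C)).
    by apply: ler_prod => j _; rewrite normr_ge0 fle.
  rewrite -rmorph_prod lecR -expR_sum ler_expR -mulr_suml exprS invfM mulrC.
  rewrite ler_pM2l ?invr_gt0//; have := sum_bin_geometric 0 n r0 r1.
  by under eq_bigr do rewrite bin0 mul1r.
have rj j : r ^+ j.+1 <= r ^+ j by rewrite exprS ler_piMl ?exprn_ge0// ltW.
have rj1 j : r ^+ j.+1 <= r by rewrite exprS ler_piMr// exprn_ile1// ltW.
have qj j : `|q * q ^+ j| = (r ^+ j.+1)%:C.
  by rewrite -exprS normrX rE rmorphXn.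
have rd j : 0 <= r ^+ j / (1 - r) by rewrite divr_ge0 ?exprn_ge0// ltW.
exists (expR ((1 - r) ^- 2))%:C => n.
  apply: prod_le => j; rewrite (le_trans (ler_normB _ _))// normr1 qj.
  rewrite -(rmorph1 (real_complex R)) -rmorphD lecR.
  rewrite (le_trans _ (expR_ge1Dx _))// lerD2l (le_trans (rj j))//.
  by rewrite ler_pdivlMr// ler_piMr ?exprn_ge0// gerBl.
rewrite -normfV /qpoch -prodfV; apply: prod_le => j; rewrite normfV.
have d0 : 0 < 1 - r ^+ j.+1 by rewrite subr_gt0 (le_lt_trans (rj1 j)).
have dle : (1 - r ^+ j.+1)%:C <= `|1 - q * q ^+ j|.
  by have := lerB_dist 1 (q * q ^+ j); rewrite normr1 qj rmorphB rmorph1.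
have dC : 0 < (1 - r ^+ j.+1)%:C :> R[i] by rewrite ltcR.
apply: (@le_trans _ _ (1 - r ^+ j.+1)%:C^-1).
  by rewrite lef_pV2// posrE (lt_le_trans dC).
rewrite -fmorphV lecR (le_trans _ (expR_ge1Dx _))//.
have -> : (1 - r ^+ j.+1)^-1 = 1 + r ^+ j.+1 / (1 - r ^+ j.+1).
  by field; rewrite gt_eqF.
by rewrite lerD2l ler_pM ?exprn_ge0 ?invr_ge0 ?(ltW d0)//
  lef_pV2 ?posrE ?lerD2l ?lerN2.
Qed.

(** The successive differences -(q;q)_k q^(k+1) are absolutely summable; the partial products are
    recovered by telescoping from (q;q)_0 = 1. *)
Lemma qpoch_is_cvg {R : realType} {q : R[i]} : `|q| < 1 -> cvgn (qpoch q q).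
Proof.
move=> q1; have [a Pa _] := qpoch_bounded q1.
have q10 : 0 < 1 - `|q| by rewrite subr_gt0.
have a0 : 0 <= a := le_trans (normr_ge0 _) (Pa 0).
have : cvgn (series (fun k => qpoch q q k.+1 - qpoch q q k)).
  apply: (complex_series_is_cvg (a / (1 - `|q|))) => n.
  apply: (@le_trans _ _ (a * \sum_(0 <= k < n) 'C(k, 0)%:R * `|q| ^+ k)).
    rewrite mulr_sumr ler_sum// => k _.
    rewrite qpochS mulrBr mulr1 addrAC subrr add0r normrN.
    rewrite -exprS normrM normrX bin0 mul1r ler_pM//.
    by rewrite exprS ler_piMl ?exprn_ge0// (ltW q1).
  by rewrite ler_wpM2l// (le_trans (sum_bin_geometric 0 n (normr_ge0 q) q1)).
move=> /cvg_ex[l sl]; apply/cvg_ex; exists (l + 1).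
have -> : qpoch q q =
    fun n => series (fun k => qpoch q q k.+1 - qpoch q q k) n + 1.
  apply/funext => n; rewrite /series/= telescope_sumr//.
  by rewrite [qpoch q q 0]/qpoch big_geq// subrK.
have c1 : (fun=> 1 : R[i]) @ \oo --> (1 : R[i]).
  apply/cvg_complexP; split; exact: cvg_cst.
exact: (cvg_complexD sl c1).
Qed.

Lemma exprS_neq1 {K : numFieldType} {q : K} : `|q| < 1 ->
  forall j, q ^+ j.+1 != 1.
Proof.
move=> q1 j; have : `|q ^+ j.+1| < 1.
  by rewrite normrX exprS (le_lt_trans _ q1)// ler_piMr// exprn_ile1// ltW.
by apply: contraTneq => ->; rewrite normr1 ltxx.
Qed.

(** Serves twice: |q|^(n-k) is the decay of (q;q)_n - (q;q)_(n-k) in the comparison of sums, and n =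
    k bounds the bare term of the series. *)
Lemma norm_bin2_term_le {K : numFieldType} {q a : K} (n k : nat) :
  0 < `|q| -> `|q| < 1 -> (forall n, `|qpoch q q n|^-1 <= a) -> (k <= n)%N ->
  `|'C(k, 2)%:R * ((-1) ^+ k * q ^+ 'C(k, 2) / qpoch q q k)| * `|q| ^+ (n - k)
    <= a * `|q| ^- 3 * `|q| ^+ n * ('C(k, 2)%:R * `|q| ^+ k).
Proof.
move=> q0 q1 Pa kn; rewrite !normrM normr_nat normrX normrN1 expr1n mul1r.
rewrite normfV normrX.
have -> : a * `|q| ^- 3 * `|q| ^+ n * ('C(k, 2)%:R * `|q| ^+ k) =
    'C(k, 2)%:R * (`|q| ^- 3 * (`|q| ^+ n * `|q| ^+ k) * a) by ring.
rewrite -[leLHS]mulrA ler_wpM2l// mulrAC.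
by rewrite ler_pM// ?mulr_ge0 ?exprn_ge0 ?invr_ge0// ler_bin2_expr.
Qed.

Lemma bin2_series_is_cvg {R : realType} {q : R[i]} : 0 < `|q| -> `|q| < 1 ->
  cvgn (series (fun k =>
    'C(k, 2)%:R * ((-1) ^+ k * q ^+ 'C(k, 2) / qpoch q q k))).
Proof.
move=> q0 q1; have [a _ Pa] := qpoch_bounded q1.
have a0 : 0 <= a by rewrite (le_trans _ (Pa 0))// invr_ge0.
have c0 : 0 <= a * `|q| ^- 3 by rewrite mulr_ge0// invr_ge0 exprn_ge0.
apply: (complex_series_is_cvg (a * `|q| ^- 3 * (1 - `|q|) ^- 3)) => n.
apply: le_trans (ler_wpM2l c0 (sum_bin_geometric 2 n (normr_ge0 q) q1)).
rewrite mulr_sumr ler_sum// => k _.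
have := norm_bin2_term_le k k q0 q1 Pa (leqnn k).
rewrite subnn mulr1 => /le_trans; apply.
rewrite ler_wpM2r ?mulr_ge0 ?exprn_ge0//.
by rewrite ler_piMr// exprn_ile1// ltW.
Qed.

Lemma bin2_qbinom_sum_sub_cvg0 {R : realType} {q : R[i]} :
  0 < `|q| -> `|q| < 1 ->
  \sum_(0 <= k < n.+1)
      'C(k, 2)%:R * qbinom q n k * (-1) ^+ k * q ^+ 'C(k, 2) -
    \sum_(0 <= k < n.+1)
      'C(k, 2)%:R * ((-1) ^+ k * q ^+ 'C(k, 2) / qpoch q q k)
    @[n --> \oo] --> (0 : R[i]).
Proof.
move=> q0 q1; have [a Pa PVa] := qpoch_bounded q1.
have q10 : 0 < 1 - `|q| by rewrite subr_gt0.
have a0 : 0 <= a := le_trans (normr_ge0 _) (Pa 0).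
have qn := exprS_neq1 q1.
apply: (cvg_complex0_geometric
  (a / (1 - `|q|) * a * (a * `|q| ^- 3) * (1 - `|q|) ^- 3) `|q|) => // n.
rewrite -sumrB (le_trans (ler_norm_sum _ _ _))//.
(* The factors bound, in order, the difference of Pochhammer symbols, the inverse of (q;q)_(n-k),
   and the term of the series. *)
pose c := a / (1 - `|q|) * a * (a * `|q| ^- 3) * `|q| ^+ n.
have c0 : 0 <= c.
  by rewrite /c ?(mulr_ge0, divr_ge0, invr_ge0, exprn_ge0)// ltW.
apply: (@le_trans _ _ (c * \sum_(0 <= k < n.+1) 'C(k, 2)%:R * `|q| ^+ k));
  last first.
  by rewrite [leRHS]mulrAC ler_wpM2l// sum_bin_geometric.
rewrite mulr_sumr big_nat_cond [leRHS]big_nat_cond.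
apply: ler_sum => k; rewrite andbT ltnS /= => kn.
have -> : 'C(k, 2)%:R * qbinom q n k * (-1) ^+ k * q ^+ 'C(k, 2) -
    'C(k, 2)%:R * ((-1) ^+ k * q ^+ 'C(k, 2) / qpoch q q k) =
    (qpoch q q n - qpoch q q (n - k)) / qpoch q q (n - k) *
    ('C(k, 2)%:R * ((-1) ^+ k * q ^+ 'C(k, 2) / qpoch q q k)).
  rewrite /qbinom; field.
  by rewrite !qpoch_neq0.
rewrite normrM normrM normfV.
have Pd := qpoch_dist_le (n - k) n q1 Pa (leq_subr k n).
set t := 'C(k, 2)%:R * (_ / _).
apply: (@le_trans _ _ (a / (1 - `|q|) * a * (`|t| * `|q| ^+ (n - k)))).
  have -> : a / (1 - `|q|) * a * (`|t| * `|q| ^+ (n - k)) =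
      a / (1 - `|q|) * `|q| ^+ (n - k) * a * `|t| by ring.
  by rewrite ler_wpM2r// ler_pM// invr_ge0.
have -> : c * ('C(k, 2)%:R * `|q| ^+ k) =
    a / (1 - `|q|) * a *
    (a * `|q| ^- 3 * `|q| ^+ n * ('C(k, 2)%:R * `|q| ^+ k)).
  by rewrite /c !mulrA.
by rewrite ler_wpM2l ?norm_bin2_term_le// mulr_ge0// divr_ge0// ltW.
Qed.

(** Comparison with a geometric series, since |1 - q^k| >= 1 - |q| for k >= 1. *)
Lemma lambert_series_is_cvg {R : realType} {q : R[i]} : `|q| < 1 ->
  cvgn (fun n : nat => \sum_(1 <= k < n) q ^+ k / (1 - q ^+ k)).
Proof.
move=> q1; have q10 : 0 < 1 - `|q| by rewrite subr_gt0.
have -> : (fun n : nat => \sum_(1 <= k < n) q ^+ k / (1 - q ^+ k)) =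
    series (fun k => q ^+ k / (1 - q ^+ k)).
  (* The added term at [k = 0] is [1 / 0 = 0]. *)
  apply/funext => -[|n]; first by rewrite /series/= !big_geq.
  by rewrite /series/= [RHS]big_ltn// expr0 subrr invr0 mulr0 add0r.
apply: (complex_series_is_cvg ((1 - `|q|)^-1 * (1 - `|q|) ^- 1)) => n.
have d0 : 0 <= (1 - `|q|)^-1 by rewrite invr_ge0 ltW.
apply: le_trans (ler_wpM2l d0 (sum_bin_geometric 0 n (normr_ge0 q) q1)).
rewrite mulr_sumr ler_sum// => -[_|k _].
  by rewrite expr0 subrr invr0 mulr0 normr0 !mulr_ge0.
rewrite bin0 mul1r normrM normrX normfV mulrC ler_wpM2r ?exprn_ge0//.
have dle : 1 - `|q| <= `|1 - q ^+ k.+1|.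
  rewrite (le_trans _ (lerB_dist _ _))// normr1 lerD2l lerN2 normrX exprS.
  by rewrite ler_piMr// exprn_ile1// ltW.
by rewrite lef_pV2// posrE (lt_le_trans q10).
Qed.

Theorem theorem2p5 (R : realType) (q : R[i])
    (q_gt0 : 0 < `|q|) (q_lt1 : `|q| < 1) :
  (forall n : nat, (1 <= n)%N ->
     \sum_(0 <= k < n.+1)
       'C(k, 2)%:R * qbinom q n k * (-1) ^+ k * q ^+ 'C(k, 2)
     = qpoch q q n.-1 * \sum_(1 <= k < n) q ^+ k / (1 - q ^+ k))
  /\
  [/\ cvgn (fun n : nat => \sum_(0 <= k < n)
              'C(k, 2)%:R * ((-1) ^+ k * q ^+ 'C(k, 2) / qpoch q q k)),
      cvgn (qpoch q q),
      cvgn (fun n : nat => \sum_(1 <= k < n) q ^+ k / (1 - q ^+ k))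
    & \big[+%R/0]_(0 <= k <oo)
        ('C(k, 2)%:R * ((-1) ^+ k * q ^+ 'C(k, 2) / qpoch q q k))
      = qpoch_inf q q * \big[+%R/0]_(1 <= k <oo) (q ^+ k / (1 - q ^+ k))].
Proof.
have fin n := sum_bin2_qbinom n (exprS_neq1 q_lt1).
split=> [[|n] //|].
have Tcvg := bin2_series_is_cvg q_gt0 q_lt1.
have Pcvg := qpoch_is_cvg q_lt1.
have Lcvg := lambert_series_is_cvg q_lt1.
split; [exact: Tcvg|exact: Pcvg|exact: Lcvg|].
rewrite -[qpoch_inf q q]/(limn (qpoch q q)).
move: Tcvg Pcvg Lcvg => /cvg_ex[T Tl] /cvg_ex[P Pl] /cvg_ex[L Ll].
rewrite (cvg_complex_lim Tl) (cvg_complex_lim Pl) (cvg_complex_lim Ll).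
(* The shifts match the finite identity at n + 1, which pairs (q;q)_n with the Lambert sum over 1 <=
   k < n + 1. *)
have T1 := Tl; rewrite -cvg_shiftS in T1.
have L1 := Ll; rewrite -cvg_shiftS in L1.
(* The finite sums thus also tend to [T]; uniqueness of limits concludes. *)
have := cvg_complexD (bin2_qbinom_sum_sub_cvg0 q_gt0 q_lt1) T1.
rewrite add0r -cvg_shiftS => Sl.
have := cvg_complexM Pl L1.
rewrite -(cvg_complex_lim Sl) => /cvg_complex_lim <-.
congr (limn _); apply/funext => n.
by rewrite /series/= subrK fin.
Qed.
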